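(* Let $G=(V,E)$ be a generalized flow network with source nodes $J\subseteq V$ and let $\mathcal P$ be its associated polytope of net-flow vectors of the sources. For any cost vector $\mathbf c\in\mathbb R^{J}$, the function $v(\mathbf x):=\max_{0\le\mathbf z\le\mathbf x,\ \mathbf z\in\mathcal P}\mathbf c\cdot\mathbf z$, $\mathbf x\in\mathbb R_{\ge0}^{J}$, is linear substitute.
   Context: Generalized flow network: a finite directed graph $G=(V,E)$; each arc $e$ has capacity $u_e\ge0$ and gain factor $\gamma_e>0$ (a flow of value $f$ entering $e$ becomes $\gamma_ef$ when leaving $e$); each node $v$ has excess capacity $b_v$, nonnegative for sources $j\in J$. The polytope is $$\mathcal P=\Big\{\mathbf z=\Big(\sum_w(f_{jw}-\gamma_{wj}f_{wj})\Big)_{j\in J}\ :\ \sum_w(f_{vw}-\gamma_{wv}f_{wv})\le b_v\ \forall v\in V;\ f_e\le u_e\ \forall e\in E;\ \mathbf f\ge0\Big\}.$$ Standing assumption (polytope scheduling): the set of nonnegative vectors in $\mathcal P$ is nonempty and contains $\mathbf 0$. Linear substitute (LS): with $\mathcal D(v,\mathbf q)=\arg\max_{\mathbf x}\{v(\mathbf x)-\mathbf q\cdot\mathbf x\}$, $v$ is LS if for all price vectors $\mathbf q,\mathbf q'\ge0$ with $q_j\le q'_j$ for one index $j$ and $q_k=q'_k$ for all $k\ne j$, and every $X\in\mathcal D(v,\mathbf q)$, there is $Y\in\mathcal D(v,\mathbf q')$ with $Y_k\ge X_k$ for all $k\ne j$. *)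

(* Defs.v *)
From HB Require Import structures.
From mathcomp Require Import all_boot all_order all_algebra.
From mathcomp Require Import all_classical all_reals.

Set Implicit Arguments.
Unset Strict Implicit.
Unset Printing Implicit Defensive.

Import Order.TTheory GRing.Theory Num.Theory.

Local Open Scope classical_set_scope.
Local Open Scope ring_scope.

Section LinearSubstitute.
Variables (R : realType) (I : finType).

Definition dotf (p x : I -> R) : R := \sum_i p i * x i.

Definition nonneg (x : I -> R) : Prop := forall i, 0 <= x i.

(* A valuation is a function on the nonnegative orthant; [v] is a total
   function here, but its values outside the orthant are never used. *)
Definition demand (v : (I -> R) -> R) (q : I -> R) : set (I -> R) :=
  [set x | nonneg x /\
     forall y, nonneg y -> v y - dotf q y <= v x - dotf q x].

Definition linear_substitute (v : (I -> R) -> R) : Prop :=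
  forall (q q' : I -> R) (j : I), nonneg q -> nonneg q' ->
    q j <= q' j -> (forall k, k != j -> q k = q' k) ->
  forall X, demand v q X ->
  exists2 Y, demand v q' Y & forall k, k != j -> X k <= Y k.

End LinearSubstitute.

(* Capacities, gains and flows are functions of the two end points of an arc;
   their values at pairs (v, w) that are not arcs are irrelevant. *)
Record gen_network (R : realType) (V : finType) := GenNetwork {
  arc : rel V;
  sources : {set V};
  capacity : V -> V -> R;
  gain : V -> V -> R;
  excess : V -> R;
  capacity_ge0 : forall v w, arc v w -> 0 <= capacity v w;
  gain_gt0 : forall v w, arc v w -> 0 < gain v w;
  excess_ge0 : forall j, j \in sources -> 0 <= excess j
}.

Section Polytope.
Variables (R : realType) (V : finType) (N : gen_network R V).

Definition source : finType := {j : V | j \in sources N}.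

Definition net_outflow (f : V -> V -> R) (v : V) : R :=
  \sum_(w | arc N v w) f v w - \sum_(w | arc N w v) gain N w v * f w v.

Definition feasible_flow (f : V -> V -> R) : Prop :=
  [/\ forall v, net_outflow f v <= excess N v,
      forall v w, arc N v w -> f v w <= capacity N v w
    & forall v w, arc N v w -> 0 <= f v w].

Definition polytope : set (source -> R) :=
  [set z | exists2 f, feasible_flow f & forall j, z j = net_outflow f (val j)].

Definition attainable_values (c x : source -> R) : set R :=
  [set dotf c z | z in
    [set z | polytope z /\ forall j, 0 <= z j <= x j]].

(* [sup] makes the value function total; whenever [attainable_values c x] has
   a maximum, it is that maximum. *)
Definition network_value (c x : source -> R) : R := sup (attainable_values c x).

End Polytope.

Definition is_maximum (R : realType) (A : set R) (m : R) : Prop :=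
  A m /\ ubound A m.

(* Main.v *)
(* If X is demanded at q and z is optimal for X, then z maximizes c - q over the
   nonnegative part of the polytope and X exceeds z only where the price is zero,
   so it suffices to compare maximizers of the linear objectives p = c - q and
   p' = c - q'.  Let f be a flow for a maximizer z of p, f' a flow for a maximizer
   of p', and g = f' - f.  If j does not receive net flow in g, then z is still
   optimal for p'.  Otherwise g has a conformal subflow r that ends entirely at j
   and leaves no other node as a net receiver: r keeps on every arc a fraction
   determined by the receiving end, and these fractions form a fixed point of a
   monotone map of the cube.  Both f + r and f' - r are feasible, and g - r does
   not involve j, so optimality of f for p makes f + r optimal for p'. *)
Require Import Defs.
From HB Require Import structures.
From mathcomp Require Import all_boot all_order all_algebra.
From mathcomp Require Import all_classical all_reals.
From mathcomp Require Import topology normedtype derive.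
From mathcomp Require Import ring lra.

Set Implicit Arguments.
Unset Strict Implicit.
Unset Printing Implicit Defensive.

Import Order.TTheory GRing.Theory Num.Theory.
Import numFieldNormedType.Exports.
Local Open Scope classical_set_scope.
Local Open Scope ring_scope.

(** * Conformal subflows from a monotone fixed point *)

(** Knaster-Tarski on the cube: the pointwise supremum [s] of the points with [a <= F a] is again
    such a point, hence so is [F s], which forces [F s <= s]. *)
Lemma monotone_cube_fixpoint (R : realType) (I : Type)
    (F : (I -> R) -> I -> R) :
  (forall a b, (forall i, a i <= b i) -> forall i, F a i <= F b i) ->
  (forall a, (forall i, 0 <= a i <= 1) -> forall i, 0 <= F a i <= 1) ->
  exists2 a, (forall i, 0 <= a i <= 1) & forall i, F a i = a i.
Proof.
move=> Fmono Fcube.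
pose P (a : I -> R) := (forall i, 0 <= a i <= 1) /\ forall i, a i <= F a i.
pose E i := [set a i | a in P].
have P0 : P (fun=> 0).
  split=> i; first by rewrite lexx ler01.
  by have /(_ i)/andP[] := @Fcube (fun=> 0) (fun=> introT andP (conj (lexx 0) ler01)).
have E0 i : E i !=set0 by exists 0; exists (fun=> 0).
have Eub i : ubound (E i) 1 by move=> _ [a [/(_ i)/andP[_ a1] _] <-].
pose s i := sup (E i).
have Ps a i : P a -> a i <= s i.
  by move=> Pa; apply: ub_le_sup; [exists 1 | exists a].
have s01 i : 0 <= s i <= 1 by rewrite (Ps _ i P0) /= ge_sup.
have sF i : s i <= F s i.
  apply: ge_sup => // _ [a Pa <-].
  by apply: le_trans (Pa.2 i) _; apply: Fmono => k; apply: Ps.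
exists s => // i; apply/eqP; rewrite eq_le sF andbT.
by apply: (Ps (F s)); split=> k; [apply: Fcube | apply: Fmono].
Qed.

(* [S v w] is the amount sent from [v] towards [w], [T v] the amount arriving at
   [v], and [a w] the retained fraction of everything that arrives at [w]. *)
Lemma retained_fractions (R : realType) (V : finType) (S : V -> V -> R)
    (T : V -> R) (j : V) :
  (forall v w, 0 <= S v w) -> (forall v, 0 <= T v) ->
  \sum_w S j w < T j ->
  exists a : V -> R, [/\ forall v, 0 <= a v <= 1,
    \sum_w a w * S j w - a j * T j = \sum_w S j w - T j
  & forall v, v != j ->
    0 <= \sum_w a w * S v w - a v * T v <= Num.max 0 (\sum_w S v w - T v)].
Proof.
move=> S0 T0 jT.
(* The fixed-point equation lets a node keep only as much as it sends on; the extra term [e] lets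
   [j] keep its whole net surplus as well. *)
pose e v := if v == j then T j - \sum_w S j w else 0.
(* Where nothing arrives, any constant in [0, 1] would do as the fraction. *)
pose F (a : V -> R) v :=
  if T v == 0 then 1 else Num.min 1 ((\sum_w a w * S v w + e v) / T v).
have e0 v : 0 <= e v by rewrite /e; case: ifP => // _; rewrite subr_ge0 ltW.
have Fmono a b : (forall i, a i <= b i) -> forall i, F a i <= F b i.
  move=> ab v; rewrite /F; case: ifP => // _.
  rewrite le_min2// ler_wpM2r ?invr_ge0// lerD2r ler_sum// => w _.
  by rewrite ler_wpM2r.
have Fcube a : (forall i, 0 <= a i <= 1) -> forall i, 0 <= F a i <= 1.
  move=> a01 v; rewrite /F; case: ifP => _; first by rewrite ler01 lexx.
  rewrite le_min ler01 ge_min lexx /= andbT divr_ge0// addr_ge0// sumr_ge0// => w _.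
  by rewrite mulr_ge0//; case/andP: (a01 w).
have [a a01 Fa] := monotone_cube_fixpoint Fmono Fcube.
have sumS0 v : 0 <= \sum_w a w * S v w.
  by apply: sumr_ge0 => w _; rewrite mulr_ge0//; case/andP: (a01 w).
have sumS v : \sum_w a w * S v w <= \sum_w S v w.
  by apply: ler_sum => w _; rewrite ler_piMl//; case/andP: (a01 w).
exists a; split=> //.
  have Tj : 0 < T j by apply: le_lt_trans jT; exact: sumr_ge0.
  have := Fa j; rewrite /F gt_eqF// /e eqxx min_r => [<-|].
    by rewrite mulfVK ?gt_eqF//; ring.
  by rewrite ler_pdivrMr// mul1r; have := sumS j; lra.
move=> v vj; have := Fa v; rewrite /F /e (negPf vj) addr0.
case: eqP => [-> _|/eqP Tv].
  by rewrite mulr0 !subr0 sumS0 /= le_max sumS orbT.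
have Tv0 : 0 < T v by rewrite lt_def Tv T0.
(* If the cap binds, [v] keeps all arrivals and its net outflow can only drop from the unscaled one;
   otherwise [v] is exactly balanced. *)
have [le1 <-|lt1 <-] := leP 1 (_ / T v).
  move: le1; rewrite ler_pdivlMr// mul1r subr_ge0 => ->/=.
  by rewrite le_max lerD2r sumS orbT.
by rewrite mulfVK// subrr lexx /= le_max lexx.
Qed.

Lemma net_outflowD (R : realType) (V : finType) (N : gen_network R V)
    (f g : V -> V -> R) (v : V) :
  net_outflow N (fun x y => f x y + g x y) v
  = net_outflow N f v + net_outflow N g v.
Proof.
rewrite /net_outflow big_split /=.
under [X in _ - X]eq_bigr do rewrite mulrDr.
by rewrite big_split /=; ring.
Qed.

Lemma net_outflowB (R : realType) (V : finType) (N : gen_network R V)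
    (f g : V -> V -> R) (v : V) :
  net_outflow N (fun x y => f x y - g x y) v
  = net_outflow N f v - net_outflow N g v.
Proof.
rewrite /net_outflow sumrB.
under [X in _ - X]eq_bigr do rewrite mulrBr.
by rewrite sumrB; ring.
Qed.

(* A negative [g v w] is a shipment from [w] to [v]. *)
Lemma subflow_into (R : realType) (V : finType) (N : gen_network R V)
    (g : V -> V -> R) (j : V) : net_outflow N g j < 0 ->
  exists r : V -> V -> R,
  [/\ forall v w, exists2 a, 0 <= a <= 1 & r v w = a * g v w,
      net_outflow N r j = net_outflow N g j
    & forall v, v != j ->
      0 <= net_outflow N r v <= Num.max 0 (net_outflow N g v)].
Proof.
pose pos (x : R) : R := Num.max 0 x; pose neg (x : R) : R := Num.max 0 (- x).
have pos0 x : 0 <= pos x by rewrite le_max lexx.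
have neg0 x : 0 <= neg x by rewrite le_max lexx.
have posneg x : pos x - neg x = x.
  by rewrite /pos /neg; case: (leP 0 x) => ?; case: (leP 0 (- x)) => ?; lra.
(* [S v w] and [T v] are both measured at [v]. On a reversed arc the head pays the gain times the
   amount that the tail receives. *)
pose S v w := (if Defs.arc N v w then pos (g v w) else 0)
  + (if Defs.arc N w v then gain N w v * neg (g w v) else 0).
pose T v := \sum_(w | Defs.arc N v w) neg (g v w)
  + \sum_(w | Defs.arc N w v) gain N w v * pos (g w v).
(* Each shipment is scaled by the fraction of its receiving end: [w] for the positive part, [v] for
   the negative part. *)
pose r (a : V -> R) v w := a w * pos (g v w) - a v * neg (g v w).
have outr a v : net_outflow N (r a) v = \sum_w a w * S v w - a v * T v.
  rewrite /net_outflow /r /T.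
  under [X in _ = X - _]eq_bigr do rewrite mulrDr.
  under [X in _ - X = _]eq_bigr do rewrite mulrBr.
  rewrite !sumrB big_split /= mulrDr !mulr_sumr.
  have -> : \sum_w a w * (if Defs.arc N v w then pos (g v w) else 0)
      = \sum_(w | Defs.arc N v w) a w * pos (g v w).
    rewrite [RHS]big_mkcond; apply: eq_bigr => w _.
    by case: ifP; rewrite ?mulr0.
  have -> : \sum_w a w * (if Defs.arc N w v then gain N w v * neg (g w v) else 0)
      = \sum_(w | Defs.arc N w v) gain N w v * (a w * neg (g w v)).
    rewrite [RHS]big_mkcond; apply: eq_bigr => w _.
    by case: ifP; rewrite ?mulr0// mulrCA.
  have -> : \sum_(w | Defs.arc N w v) a v * (gain N w v * pos (g w v))
      = \sum_(w | Defs.arc N w v) gain N w v * (a v * pos (g w v)).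
    by apply: eq_bigr => w _; rewrite mulrCA.
  by ring.
have g1 v : net_outflow N g v = \sum_w S v w - T v.
  have -> : \sum_w S v w - T v = net_outflow N (r (fun=> 1)) v.
    by rewrite outr mul1r; under [X in _ = X - _]eq_bigr do rewrite mul1r.
  by rewrite /net_outflow; congr (_ - _); apply: eq_bigr => w _;
    rewrite /r !mul1r posneg.
rewrite g1 subr_lt0 => /retained_fractions[||a [a01 aj aV]].
- move=> v w; rewrite addr_ge0//; case: ifP => // /gain_gt0/ltW ?.
  by rewrite mulr_ge0.
- move=> v; rewrite addr_ge0 ?sumr_ge0// => w /gain_gt0/ltW ?.
  by rewrite mulr_ge0.
exists (r a); split=> [v w||v vj]; rewrite ?outr ?g1//; last exact: aV.
exists (if 0 <= g v w then a w else a v); first by case: ifP.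
rewrite /r /pos /neg; case: ifP => g0.
  by rewrite max_r// max_l ?oppr_le0// mulr0 subr0.
have {}g0 : g v w <= 0 by move/negbT: g0; rewrite -ltNge => /ltW.
by rewrite max_l// max_r ?oppr_ge0// mulr0 sub0r mulrN opprK.
Qed.

(** * Existence of optimal flows by compactness *)

Lemma eq_net_outflow (R : realType) (V : finType) (N : gen_network R V)
    (f g : V -> V -> R) :
  (forall v w, Defs.arc N v w -> f v w = g v w) ->
  net_outflow N f =1 net_outflow N g.
Proof.
move=> fg v; rewrite /net_outflow.
by congr (_ - _); apply: eq_bigr => w vw; rewrite fg.
Qed.

(** The admissible flows form a closed subset of a product of segments, compact by Tychonoff, and
    the objective is continuous in the flow; the zero vector gives nonemptiness. *)
Lemma attainable_max (R : realType) (V : finType) (N : gen_network R V)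
    (c x : source N -> R) :
  polytope (N := N) (fun=> 0) -> nonneg x ->
  exists2 z, polytope z /\ (forall j, 0 <= z j <= x j) &
    forall y, polytope y -> (forall j, 0 <= y j <= x j) -> dotf c y <= dotf c z.
Proof.
move=> P0 x0.
pose T : topologicalType := prod_topology (fun _ : V * V => R).
(* Coordinates off the arcs are unconstrained in a feasible flow; pinning them to 0 makes the box
   compact without changing any net outflow. *)
pose u e := if Defs.arc N e.1 e.2 then capacity N e.1 e.2 else 0.
pose D v (f : T) : R := net_outflow N (fun a b => f (a, b)) v.
pose box : set T := [set f | forall e, `[0, u e]%classic (f e)].
pose A : set T := box `&` ((\bigcap_(v in setT) [set f | D v f <= excess N v]) `&`
  (\bigcap_(i in [set: source N])
    ([set f | 0 <= D (val i) f] `&` [set f | D (val i) f <= x i]))).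
have proj_cont (e : V * V) : continuous (fun f : T => f e : R).
  exact: (@proj_continuous _ (fun _ : V * V => R)).
have sum_cont (I : finType) (P : pred I) (F : I -> T -> R) :
    (forall i, P i -> continuous (F i)) ->
    continuous (fun f => \sum_(i | P i) F i f).
  by move=> cF; apply: continuous_big => //; exact: add_continuous.
have mul_cont (k : R) (F : T -> R) : continuous F -> continuous (fun f => k * F f).
  by move=> cF f; exact: (@cvgMl_tmp R _ (nbhs f) _ F k _ (cF f)).
have sub_cont (F G : T -> R) :
    continuous F -> continuous G -> continuous (fun f => F f - G f).
  by move=> cF cG f; exact: (@cvgB R _ _ (nbhs f) _ F G _ _ (cF f) (cG f)).
have Dcont v : continuous (D v).
  apply: sub_cont; apply: sum_cont => w _; first exact: proj_cont.
  by apply: mul_cont; exact: proj_cont.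
have Acpt : compact A.
  apply: compact_closedI.
    apply: (@tychonoff _ (fun _ : V * V => R) (fun e => `[0, u e]%classic)) => e.
    exact: segment_compact.
  apply: closedI; apply: closed_bigI => i _.
    by apply: preimage_closed (@closed_le _ _) => f _; exact: Dcont.
  apply: closedI.
    by apply: preimage_closed (@closed_ge _ _) => f _; exact: Dcont.
  by apply: preimage_closed (@closed_le _ _) => f _; exact: Dcont.
have liftA y : polytope y -> (forall j, 0 <= y j <= x j) ->
    exists2 f, A f & forall j, y j = D (val j) f.
  move=> [g [gb gu g0] yg] yx.
  pose f (e : V * V) := if Defs.arc N e.1 e.2 then g e.1 e.2 else 0.
  have Df v : D v f = net_outflow N g v.
    by apply: eq_net_outflow => a b ab; rewrite /f ab.
  exists f => [|j]; last by rewrite Df.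
  split=> [e|].
    rewrite /= in_itv /f /u; case: ifPn => ab /=; last by rewrite !lexx.
    by rewrite g0//= gu.
  split=> [v _ | i _]; rewrite /= Df; first exact: gb.
  by rewrite -yg; apply/andP.
have [|f|f fA fmax] := @compact_EVT_max T R (fun f => dotf c (fun j => D (val j) f)) A _ Acpt.
- have [|f Af _] := liftA _ P0; last by exists f.
  by move=> j; rewrite lexx x0.
- apply: continuous_subspaceT => {}f; apply: sum_cont => i _.
  by apply: mul_cont; exact: Dcont.
have /set_mem[fbox [fb fx]] := fA.
exists (fun j => D (val j) f).
  split; last by move=> j; apply/andP; exact: fx.
  exists (fun a b => f (a, b)) => //; split=> [v|v w vw|v w vw]; first exact: fb.
    by have := fbox (v, w); rewrite /= in_itv /u /= vw => /andP[].
  by have := fbox (v, w); rewrite /= in_itv /u /= vw => /andP[].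
move=> y Py yx; have [g Ag yg] := liftA _ Py yx.
have -> : dotf c y = dotf c (fun j => D (val j) g).
  by apply: eq_bigr => j _; rewrite yg.
by apply: fmax; exact: mem_set.
Qed.

Lemma is_maximum_sup (R : realType) (A : set R) (m : R) :
  is_maximum A m -> sup A = m.
Proof.
move=> [Am ubm]; apply/eqP; rewrite eq_le ge_sup//=; last by exists m.
by apply: ub_le_sup => //; exists m.
Qed.

(** * Linear objectives over the nonnegative part of the polytope *)

Lemma dotfB_price (R : realType) (I : finType) (p q x : I -> R) :
  dotf (fun i => p i - q i) x = dotf p x - dotf q x.
Proof. by rewrite /dotf -sumrB; apply: eq_bigr => i _; rewrite mulrBl. Qed.

Lemma dotfD (R : realType) (I : finType) (p x y : I -> R) :
  dotf p (fun i => x i + y i) = dotf p x + dotf p y.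
Proof. by rewrite /dotf -big_split; apply: eq_bigr => i _; rewrite mulrDr. Qed.

Lemma dotfB (R : realType) (I : finType) (p x y : I -> R) :
  dotf p (fun i => x i - y i) = dotf p x - dotf p y.
Proof. by rewrite /dotf -sumrB; apply: eq_bigr => i _; rewrite mulrBr. Qed.

Lemma dotf_change1 (R : realType) (I : finType) (p q x : I -> R) (j : I) :
  (forall k, k != j -> p k = q k) ->
  dotf p x - dotf q x = (p j - q j) * x j.
Proof.
move=> pq; rewrite -dotfB_price /dotf (bigD1 j)//= big1 ?addr0// => i ij.
by rewrite pq// subrr mul0r.
Qed.

Lemma ler_dotf (R : realType) (I : finType) (p x y : I -> R) :
  nonneg p -> (forall i, x i <= y i) -> dotf p x <= dotf p y.
Proof. by move=> p0 xy; apply: ler_sum => i _; rewrite ler_wpM2l. Qed.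

Definition nonneg_polytope (R : realType) (V : finType) (N : gen_network R V) :
  set (source N -> R) := [set z | polytope z /\ nonneg z].

Definition maximizers (R : realType) (I : finType) (P : set (I -> R))
    (p : I -> R) : set (I -> R) :=
  [set z | P z /\ forall y, P y -> dotf p y <= dotf p z].

(** The excesses of the sources bound every vector of the polytope, so taking them as [x] adds no
    constraint. *)
Lemma nonneg_polytope_max (R : realType) (V : finType) (N : gen_network R V)
    (p : source N -> R) :
  polytope (N := N) (fun=> 0) -> maximizers (nonneg_polytope (N := N)) p !=set0.
Proof.
move=> P0; have excess0 : nonneg (fun j : source N => excess N (val j)).
  by move=> j; apply: excess_ge0; exact: valP.
have [z [Pz zx] zmax] := attainable_max p P0 excess0.
exists z; split; first by split=> // j; case/andP: (zx j).
move=> y [Py y0]; apply: zmax => // j; rewrite y0 /=.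
by case: Py => f [fb _ _] ->.
Qed.

Lemma between_convex (R : realType) (a x y : R) : 0 <= a <= 1 ->
  Num.min x y <= x + a * (y - x) <= Num.max x y.
Proof.
move=> /andP[a0 a1]; have b0 : 0 <= 1 - a by rewrite subr_ge0.
case: (leP x y) => [xy|/ltW xy]; move: xy; rewrite -subr_ge0 => xy;
  by have := mulr_ge0 a0 xy; have := mulr_ge0 b0 xy; lra.
Qed.

(** * Exchange between two optimal flows *)

Lemma maximizer_substitute (R : realType) (V : finType) (N : gen_network R V)
    (p p' : source N -> R) (j : source N) (z : source N -> R) :
  polytope (N := N) (fun=> 0) ->
  p' j <= p j -> (forall k, k != j -> p k = p' k) ->
  maximizers (nonneg_polytope (N := N)) p z ->
  exists2 z', maximizers (nonneg_polytope (N := N)) p' z' &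
    forall k, k != j -> z k <= z' k.
Proof.
move=> P0 pj pk zmax; have [[[f [fb fu f0] zf] z0] zopt] := zmax.
have [s [[[f' [fb' fu' f0'] sf'] s0] sopt]] := nonneg_polytope_max p' P0.
pose g v w := f' v w - f v w.
have [|gj] := leP 0 (net_outflow N g (val j)).
  rewrite net_outflowB -zf -sf' => zs; exists z => //.
  (* Here [z j <= s j], so passing from [p] to [p'] costs [z] no more than [s], and [z] was already
     at least as good for [p]. *)
  split=> [|y Py]; first exact: (zmax.1).
  apply: le_trans (sopt _ Py) _.
  have := dotf_change1 s pk; have := dotf_change1 z pk.
  have := zopt s (conj (ex_intro2 _ _ f' (And3 fb' fu' f0') sf') s0).
  nra.
have [r [rg rj rV]] := subflow_into gj.
have rbound v : Num.min 0 (net_outflow N g v) <= net_outflow N r v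
    <= Num.max 0 (net_outflow N g v).
  have [->|vj] := eqVneq v (val j); first by rewrite rj ge_min le_max lexx !orbT.
  have /andP[r0 ->] := rV _ vj; rewrite andbT.
  by apply: le_trans r0; rewrite ge_min lexx.
(* [f + r] and [f' - r] both lie between [f] and [f'], arcwise and nodewise. *)
have feas h : (forall v w, exists2 a, 0 <= a <= 1 &
      h v w = f v w + a * (f' v w - f v w)) ->
    (forall v, Num.min (net_outflow N f v) (net_outflow N f' v)
      <= net_outflow N h v
      <= Num.max (net_outflow N f v) (net_outflow N f' v)) ->
    nonneg_polytope (fun k : source N => net_outflow N h (val k)).
  move=> hE hb; split; last first.
    move=> k; have /andP[hk _] := hb (val k); apply: le_trans hk.
    by rewrite le_min -zf -sf' z0 s0.
  exists h => //; split=> [v|v w vw|v w vw].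
  - have /andP[_ hv] := hb v; apply: le_trans hv _.
    by rewrite ge_max fb fb'.
  - have [a a01 ->] := hE v w.
    have /andP[_ H] := between_convex (f v w) (f' v w) a01.
    by apply: le_trans H _; rewrite ge_max fu// fu'.
  - have [a a01 ->] := hE v w.
    have /andP[H _] := between_convex (f v w) (f' v w) a01.
    by apply: le_trans H; rewrite le_min f0// f0'.
have Pr : nonneg_polytope (fun k : source N => z k + net_outflow N r (val k)).
  have -> : (fun k : source N => z k + net_outflow N r (val k)) =
      (fun k : source N => net_outflow N (fun v w => f v w + r v w) (val k)).
    by apply/funext => k; rewrite net_outflowD zf.
  apply: feas => [v w|v].
    by have [a a01 ->] := rg v w; exists a.
  rewrite net_outflowD; have := rbound v; rewrite net_outflowB.
  set x := net_outflow N f v; set y := net_outflow N f' v.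
  by rewrite ge_min le_max ge_min le_max; case: (leP x y); case: (leP 0 (y - x)); lra.
have Ps : nonneg_polytope (fun k : source N => s k - net_outflow N r (val k)).
  have -> : (fun k : source N => s k - net_outflow N r (val k)) =
      (fun k : source N => net_outflow N (fun v w => f' v w - r v w) (val k)).
    by apply/funext => k; rewrite net_outflowB sf'.
  apply: feas => [v w|v].
    have [a /andP[a0 a1] ->] := rg v w; exists (1 - a); first lra.
    by rewrite /g; ring.
  rewrite net_outflowB; have := rbound v; rewrite net_outflowB.
  set x := net_outflow N f v; set y := net_outflow N f' v.
  by rewrite ge_min le_max ge_min le_max; case: (leP x y); case: (leP 0 (y - x)); lra.
exists (fun k => z k + net_outflow N r (val k)).
  split=> // y Py; apply: le_trans (sopt _ Py) _.
  pose rs (k : source N) := net_outflow N r (val k).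
  (* Since [s - rs] agrees with [z] at [j], the change from [p] to [p'] alters both values equally;
     optimality of [z] for [p] then yields [dotf p' s <= dotf p' z + dotf p' rs]. *)
  have sz : s j - rs j = z j by rewrite /rs rj net_outflowB sf' zf; ring.
  have le_z : dotf p s - dotf p rs <= dotf p z by rewrite -dotfB; exact: zopt.
  have : dotf p s - dotf p rs - (dotf p' s - dotf p' rs) = dotf p z - dotf p' z.
    by rewrite -!dotfB !(dotf_change1 _ pk) sz.
  rewrite (dotfD p' z rs); lra.
move=> k kj; rewrite lerDl.
by have /andP[] := rV (val k) (contra_neq (@val_inj _ _ _ _ _) kj).
Qed.

(** * From maximizers to demand sets *)

Theorem theorem2p16 (R : realType) (V : finType) (N : gen_network R V)
    (P0 : polytope (N := N) (fun=> 0)) (c : source N -> R) :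
  (forall x, nonneg x ->
     is_maximum (attainable_values c x) (network_value c x)) /\
  linear_substitute (network_value c).
Proof.
have value_max x : nonneg x ->
    is_maximum (attainable_values c x) (network_value c x).
  move=> x0; have [z [Pz zx] zmax] := attainable_max c P0 x0.
  have zM : is_maximum (attainable_values c x) (dotf c z).
    split; first by exists z.
    by move=> _ [y [Py yx] <-]; exact: zmax.
  by rewrite /network_value (is_maximum_sup zM).
split=> // q q' j q0 q0' qj qk X [X0 Xmax].
have value_ge x z : polytope z -> nonneg z -> (forall k, z k <= x k) ->
    dotf c z <= network_value c x.
  move=> Pz z0 zx; have x0 : nonneg x by move=> k; apply: le_trans (zx k).
  apply: (value_max x x0).2; exists z => //; split=> // k.
  by rewrite z0 zx.
have [[z [Pz zX] cz] _] := value_max X X0.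
have z0 : nonneg z by move=> k; case/andP: (zX k).
have zleX k : z k <= X k by case/andP: (zX k).
(* The bundle [z] has at least the value of [X], so demand for [X] forbids [z] from being
   cheaper. *)
have qz : dotf q z = dotf q X.
  apply/eqP; rewrite eq_le ler_dotf//=.
  by have := Xmax z z0; have := value_ge z z Pz z0 (fun=> lexx _); rewrite -cz; lra.
have slack k : q k * (X k - z k) = 0.
  have : dotf q (fun k => X k - z k) = 0 by rewrite dotfB qz subrr.
  move/eqP; rewrite psumr_eq0 => [/allP/(_ k)|i _].
    by rewrite mem_index_enum => /(_ isT)/eqP.
  by rewrite mulr_ge0 ?subr_ge0.
have zopt : maximizers (nonneg_polytope (N := N)) (fun k => c k - q k) z.
  split=> // y [Py y0]; rewrite !dotfB_price.
  by have := Xmax y y0; have := value_ge y y Py y0 (fun=> lexx _); rewrite -cz; lra.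
have [||z' [[Pz' z0'] zopt'] zz'] :=
  @maximizer_substitute _ _ _ _ (fun k => c k - q' k) j z P0 _ _ zopt.
- by rewrite lerD2l lerN2.
- by move=> k /qk ->.
(* [X] may exceed [z] at goods of price zero. Away from [j] these remain free under [q'], so [Y] can
   be raised to cover [X] there at no cost. *)
pose Y k := if (k != j) && (q k == 0) then Num.max (z' k) (X k) else z' k.
have z'Y k : z' k <= Y k by rewrite /Y; case: ifP => // _; rewrite le_max lexx.
have qY : dotf q' Y = dotf q' z'.
  apply: eq_bigr => k _; rewrite /Y; case: ifP => // /andP[/qk <- /eqP ->].
  by rewrite !mul0r.
exists Y.
  split=> [k|y y0]; first exact: le_trans (z'Y k).
  (* An optimal [t] for [y] has the same value and costs no more, and [z'] beats [t]; [Y] costs the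
     same as [z'] and is worth at least as much. *)
  have [[t [Pt ty] <-] _] := value_max y y0.
  have t0 : nonneg t by move=> k; case/andP: (ty k).
  have tley k : t k <= y k by case/andP: (ty k).
  have := zopt' t (conj Pt t0); rewrite !dotfB_price.
  have := ler_dotf q0' tley; have := value_ge Y z' Pz' z0' z'Y.
  by rewrite qY; lra.
move=> k kj; rewrite /Y kj /=; case: ifPn => [_|qk0].
  by rewrite le_max lexx orbT.
have /eqP := slack k; rewrite mulf_eq0 (negPf qk0) /= subr_eq0 => /eqP ->.
exact: zz'.
Qed.
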